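(* Let $K$ be a field of prime characteristic $p$, $S=K[x_1,\ldots,x_n]$ the standard graded polynomial ring, $I\subsetneq S$ a graded ideal, and $\mathfrak{p}\in\mathrm{Ass}(I)$, where $\mathfrak{p}$ is minimally generated by homogeneous elements $g_1,\ldots,g_m$. Then for all powers $q>1$ of $p$, $$\mathrm{v}(I^{[q]})\leq q\,\mathrm{v}_{\mathfrak{p}}(I)+(q-1)\sum_{i=1}^m\deg g_i.$$ In particular, if all the associated primes of $I$ are generated by linear forms, then for all powers $q>1$ of $p$, $$\mathrm{v}(I^{[q]})\leq q\,\mathrm{v}(I)+(q-1)\,\mathrm{bight}(I).$$
   Context: The $q$-th Frobenius power of $I$ is $I^{[q]}=(a^q : a\in I)$. $\mathrm{Ass}(I)$ denotes the set of associated primes of $S/I$. For a proper graded ideal $I$ and $\mathfrak{p}\in\mathrm{Ass}(I)$, $\mathrm{v}_{\mathfrak{p}}(I)=\min\{d\ge 0\mid \exists f\in S_d \text{ with } I:f=\mathfrak{p}\}$ and $\mathrm{v}(I)=\min\{\mathrm{v}_{\mathfrak{p}}(I)\mid\mathfrak{p}\in\mathrm{Ass}(I)\}$, where $S_d$ is the degree-$d$ component of $S$. The big height $\mathrm{bight}(I)$ is the maximum of the heights of the associated primes of $I$. *)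

(* Defs.v *)
From HB Require Import structures.
From mathcomp Require Import all_boot all_order all_algebra.
From mathcomp Require Import boolp.
From mathcomp Require Import mpoly.

Set Implicit Arguments.
Unset Strict Implicit.
Unset Printing Implicit Defensive.

Import GRing.Theory.
Local Open Scope ring_scope.

(* [nat_min A] is the least element of [A], with the convention
   [nat_min A = 0] when [A] is empty. *)
Definition nat_min (A : {pred nat}) : nat :=
  if pselect (exists d, d \in A) is left exA then ex_minn exA else 0%N.

(* [nat_max A] is the greatest element of [A], with the convention
   [nat_max A = 0] when [A] is empty or unbounded. *)
Definition nat_max (A : {pred nat}) : nat :=
  nat_min [pred d | (d \in A) && `[< {in A, forall e, (e <= d)%N} >]].

(* Ideals are predicates on the ring, compared with [=i]. The library's
   [idealr_closed I] says that [I] is a PROPER ideal (it includes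
   [1 \notin I]). *)
Section Ideals.
Variable R : comNzRingType.
Implicit Types (I P G : {pred R}) (f g : R).

Definition prime_ideal P : Prop := idealr_closed P /\ prime_idealr_closed P.

Definition ideal_gen G : {pred R} :=
  [pred f | `[< exists2 s : seq (R * R),
     {in s, forall cg, cg.2 \in G} & f = \sum_(cg <- s) cg.1 * cg.2 >]].

Definition frobenius_power (q : nat) I : {pred R} :=
  ideal_gen [pred f | `[< exists2 a, a \in I & f = a ^+ q >]].

Definition colon I f : {pred R} := [pred g | f * g \in I].

(* [colon I f] is the annihilator of the class of [f] in [R / I]. *)
Definition associated_prime I P : Prop :=
  prime_ideal P /\ exists f, colon I f =i P.

Definition minimally_generates m (g : 'I_m -> R) P : Prop :=
  let generates (A : {set 'I_m}) :=
    P =i ideal_gen [pred f | [exists i in A, f == g i]] in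
  generates [set: 'I_m] /\
  forall A : {set 'I_m}, A \proper [set: 'I_m] -> ~ generates A.

Definition prime_chain (k : nat) (c : nat -> {pred R}) : Prop :=
  (forall i, (i <= k)%N -> prime_ideal (c i)) /\
  (forall i, (i < k)%N ->
     {subset c i <= c i.+1} /\ ~ {subset c i.+1 <= c i}).

Definition height P : nat :=
  nat_max [pred k | `[< exists2 c, prime_chain k c & c k =i P >]].

Definition bight I : nat :=
  nat_max [pred h | `[< exists2 P, associated_prime I P & h = height P >]].

End Ideals.

Section Graded.
Variables (n : nat) (K : fieldType).
Implicit Types (I P : {pred {mpoly K[n]}}).

Definition graded I : Prop :=
  {in I, forall f d, pihomog mdeg d f \in I}.

(* [msize f] is one more than the degree of a nonzero [f]. *)
Definition degree (f : {mpoly K[n]}) : nat := (msize f).-1.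

Definition generated_by_linear_forms P : Prop :=
  exists2 L : {pred {mpoly K[n]}},
    {in L, forall l, l \is 1.-homog} & P =i ideal_gen L.

Definition local_vnumber I P : nat :=
  nat_min [pred d | `[< exists2 f, f \is d.-homog & colon I f =i P >]].

Definition vnumber I : nat :=
  nat_min [pred d |
    `[< exists2 P, associated_prime I P & d = local_vnumber I P >]].

End Graded.

(* Main.v *)
Require Import Defs.
From HB Require Import structures.
From mathcomp Require Import all_boot all_order all_algebra.
From mathcomp Require Import boolp.
From mathcomp Require Import mpoly.

(** Let S = K[x_1, ..., x_n], write J^[q] for the Frobenius power of J and
    I : f for the colon ideal. Everything rests on the flatness of the
    Frobenius map, in the form of [frobenius_flat]: every h in S has finitely
    many coordinates F such that, for all ideals J and all s,
    s^q h lies in J^[q] iff all the s F lie in J. The coordinates come from a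
    basis of S over S^q: the monomials with exponents below q times a basis of
    K over K^q, of which only a finite independent part is ever needed.

    First bound. If P is a prime generated by homogeneous g_1, ..., g_m and
    I : f' = P, then some homogeneous component f of f' already satisfies
    I : f = P ([homogeneous_witness]), so the local v-number is attained by
    such an f. By flatness f^q is not in I^[q]. Among the products
    w = f^q g_1^(a_1) ... g_m^(a_m) with all a_i < q that are not in I^[q],
    choose one with the a_i as large as possible. Then g_i w is in I^[q] for
    all i, by maximality or, when a_i = q - 1, because (f g_i)^q is. Hence P is
    contained in I^[q] : w. Flatness gives the converse: if s w is in I^[q]
    then so is (s f)^q g^a, and I : f = P being prime one can cancel s unless
    it is in P. So I^[q] : w = P, and the degree of w is at most
    q deg f + (q - 1) sum (deg g_i).

    Second bound. Take P where the v-number of I is attained. Since P is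
    generated by linear forms, it is generated by m linearly independent ones,
    and the first bound applies with sum m; it remains to see that m is at most
    the height of P ([forms_ideal_height]), hence at most the big height of I.
    The ideals generated by the first k of these forms make a chain of primes
    of length m, because each of them is the kernel of a linear substitution.
    The height being a maximum, one also needs that chains of primes have
    bounded length: [prime_chain_length] bounds them by n, by an elementary
    argument on algebraic dependence. Finally, if I has no associated prime at
    all, neither has I^[q], by flatness again
    ([associated_prime_frobenius_power]), and its v-number is 0 by convention.
    *)

Set Implicit Arguments.
Unset Strict Implicit.
Unset Printing Implicit Defensive.

Import GRing.Theory.
Local Open Scope ring_scope.

(** * Ideals *)

Section Ideals.
Variable R : comNzRingType.
Implicit Types (J P G : {pred R}) (f g : R).

(** Unlike [idealr_closed], this allows the unit ideal, which occurs as a colon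
    ideal and as an ideal generated by an arbitrary family. *)
Definition is_ideal J : Prop :=
  0 \in J /\ forall a, {in J &, forall u v, a * u + v \in J}.

Lemma idealr_closed_is_ideal J : idealr_closed J -> is_ideal J.
Proof. by case. Qed.

Lemma is_idealM J a u : is_ideal J -> u \in J -> a * u \in J.
Proof. by case=> J0 JP Ju; rewrite -[_ * _]addr0 JP. Qed.

Lemma is_idealD J u v : is_ideal J -> u \in J -> v \in J -> u + v \in J.
Proof. by case=> J0 JP Ju Jv; rewrite -[u]mul1r JP. Qed.

Lemma is_idealB J u v : is_ideal J -> u \in J -> v \in J -> u - v \in J.
Proof. by case=> J0 JP Ju Jv; rewrite addrC -mulN1r JP. Qed.

Lemma is_ideal_sum J (T : Type) (r : seq T) (Q : pred T) (F : T -> R) :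
  is_ideal J -> (forall i, Q i -> F i \in J) -> \sum_(i <- r | Q i) F i \in J.
Proof.
move=> idJ FJ; elim/big_ind: _ => //; first by case: idJ.
by move=> u v; apply: is_idealD.
Qed.

Lemma ideal_gen_ind G (Q : R -> Prop) :
    Q 0 -> (forall c g f, g \in G -> Q f -> Q (c * g + f)) ->
  forall f, f \in ideal_gen G -> Q f.
Proof.
move=> Q0 QS f; rewrite inE => /asboolP[s sG ->].
elim: s sG => [|x s IHs] sG; first by rewrite big_nil.
rewrite big_cons; apply: QS; first by rewrite sG ?mem_head.
by apply: IHs => y ys; rewrite sG // inE ys orbT.
Qed.

Lemma ideal_gen_is_ideal G : is_ideal (ideal_gen G).
Proof.
split; first by rewrite inE; apply/asboolP; exists [::]; rewrite ?big_nil.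
move=> a u v; rewrite !inE => /asboolP[s sG ->] /asboolP[t tG ->].
apply/asboolP; exists ([seq (a * x.1, x.2) | x <- s] ++ t).
  by move=> x; rewrite mem_cat => /orP[/mapP[y ys ->]|/tG//]; apply: (sG y).
rewrite big_cat big_map mulr_sumr /=; congr (_ + _).
by apply: eq_bigr => i _; rewrite mulrA.
Qed.

Lemma mem_ideal_gen G g : g \in G -> g \in ideal_gen G.
Proof.
move=> gG; rewrite inE; apply/asboolP; exists [:: (1, g)].
  by move=> x; rewrite inE => /eqP->.
by rewrite big_seq1 mul1r.
Qed.

Lemma ideal_gen_sub G J : is_ideal J -> {subset G <= J} ->
  {subset ideal_gen G <= J}.
Proof.
move=> idJ GJ; apply: ideal_gen_ind => [|c g f gG fJ]; first by case: idJ.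
by case: idJ => _ JP; apply: JP => //; apply: GJ.
Qed.

Lemma colon_is_ideal J f : is_ideal J -> is_ideal (colon J f).
Proof.
case=> J0 JP; split; first by rewrite inE mulr0.
by move=> a u v; rewrite !inE => Ju Jv; rewrite mulrDr mulrCA JP.
Qed.

Lemma mem_frobenius_power q J a : a \in J -> a ^+ q \in frobenius_power q J.
Proof.
by move=> aJ; apply: mem_ideal_gen; rewrite inE; apply/asboolP; exists a.
Qed.

Lemma frobenius_power_is_ideal q J : is_ideal (frobenius_power q J).
Proof. exact: ideal_gen_is_ideal. Qed.

Lemma frobenius_power_sub q J : is_ideal J -> (0 < q)%N ->
  {subset frobenius_power q J <= J}.
Proof.
move=> idJ; case: q => // q _; apply: ideal_gen_sub => // f.
by rewrite inE => /asboolP[a aJ ->]; rewrite exprSr is_idealM.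
Qed.

Lemma prime_idealX P f k : prime_ideal P -> f ^+ k \in P -> f \in P.
Proof.
case=> -[_ P1 _] Pprime; elim: k => [|k IHk]; first by rewrite (negPf P1).
by rewrite exprS => /Pprime/orP[].
Qed.

End Ideals.

(** * Freeness of the polynomial ring over its q-th powers *)

Section FrobeniusFlat.
Variables (K : fieldType) (n q : nat).
Hypothesis q_pnat : [pchar K].-nat q.
Local Notation S := {mpoly K[n]}.
Local Notation exps := {ffun 'I_n -> 'I_q}.

Lemma frob_gt0 : (0 < q)%N.
Proof. by case/andP: q_pnat. Qed.

Lemma frobD (x y : K) : (x + y) ^+ q = x ^+ q + y ^+ q.
Proof. exact: exprDn_pchar. Qed.

Lemma frob_mpolyD (x y : S) : (x + y) ^+ q = x ^+ q + y ^+ q.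
Proof.
apply: exprDn_pchar; rewrite (eq_pnat _ (pchar_lalg S)) //.
Qed.

Lemma frob0 (R : nzRingType) : 0 ^+ q = 0 :> R.
Proof. by rewrite expr0n -[q == _]negbK -lt0n frob_gt0. Qed.

Lemma frob_sum (T : Type) (r : seq T) (F : T -> S) :
  (\sum_(i <- r) F i) ^+ q = \sum_(i <- r) F i ^+ q.
Proof. exact: (big_morph (fun x => x ^+ q) frob_mpolyD (frob0 _)). Qed.

(** Linear independence over the subfield of q-th powers. The families are
    sequences cut at r, so that they can be prolonged without reindexing. *)
Definition frob_indep r (e : nat -> K) : Prop :=
  forall l : nat -> K, \sum_(j < r) l j ^+ q * e j = 0 ->
    forall j, (j < r)%N -> l j = 0.

Definition extends r (e : nat -> K) r' (e' : nat -> K) : Prop :=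
  (r <= r')%N /\ forall j, (j < r)%N -> e' j = e j.

Lemma extends_trans r1 e1 r2 e2 r3 e3 :
  extends r1 e1 r2 e2 -> extends r2 e2 r3 e3 -> extends r1 e1 r3 e3.
Proof.
move=> [le12 e12] [le23 e23]; split; first exact: leq_trans le23.
by move=> j ltj; rewrite e23 ?e12 // (leq_trans ltj).
Qed.

(** Finite independent families replace a basis of K over K^q: a scalar that is
    not yet a combination of the family can be appended to it. *)
Lemma frob_indep_extend r e k : frob_indep r e ->
  exists r' e', [/\ extends r e r' e', frob_indep r' e' &
    exists l : nat -> K, k = \sum_(j < r') l j ^+ q * e' j].
Proof.
move=> ind_e; have [sp|nsp] :=
  EM (exists l : nat -> K, k = \sum_(j < r) l j ^+ q * e j).
  by exists r, e.
pose e' j := if j == r then k else e j.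
have e'E j : (j < r)%N -> e' j = e j by rewrite /e'; case: ltngtP.
have sumE (l : nat -> K) : \sum_(j < r.+1) l j ^+ q * e' j =
    \sum_(j < r) l j ^+ q * e j + l r ^+ q * k.
  rewrite big_ord_recr /= {2}/e' eqxx; congr (_ + _).
  by apply: eq_bigr => j _; rewrite e'E.
exists r.+1, e'; split.
- by split.
- move=> l; rewrite sumE => l0.
  have lr0 : l r = 0.
    apply/eqP; apply: contra_notT nsp => lr_n0.
    (* A relation that involves k expresses k through the old family. *)
    exists (fun j => - l j / l r).
    have lq_n0: l r ^+ q != 0 by rewrite expf_neq0.
    apply: (mulfI lq_n0); rewrite mulr_sumr.
    move/eqP: l0; rewrite addrC addr_eq0 => /eqP ->.
    rewrite -sumrN; apply: eq_bigr => j _.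
    have frobN (x : K) : (- x) ^+ q = - x ^+ q.
      by apply/eqP; rewrite -addr_eq0 -frobD addNr frob0.
    by rewrite expr_div_n mulrA mulrCA divff // mulr1 frobN mulNr.
  move: l0; rewrite lr0 frob0 mul0r addr0 => l0 j.
  by rewrite ltnS leq_eqVlt => /orP[/eqP->//|]; apply: ind_e.
- pose d j : K := (j == r)%:R.
  exists d; rewrite sumE /d eqxx expr1n mul1r big1 ?add0r //.
  by move=> j _; rewrite (ltn_eqF (ltn_ord j)) frob0 mul0r.
Qed.

Definition exps_mnm (a : exps) : 'X_{1..n} := [multinom (a i : nat) | i < n].

(** The combination with coordinates F of the family of the e_j X^a, where all
    exponents of X^a are below q; it is a basis of S over S^q when e is a basis
    of K over K^q. *)
Definition frob_comb r (e : nat -> K) (F : nat -> exps -> S) : S :=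
  \sum_(j < r) \sum_a F j a ^+ q * (e j *: 'X_[exps_mnm a]).

Lemma eq_frob_comb r e F G :
    (forall j a, (j < r)%N -> F j a = G j a) ->
  frob_comb r e F = frob_comb r e G.
Proof.
move=> eqFG; apply: eq_bigr => j _; apply: eq_bigr => a _.
by rewrite eqFG.
Qed.

Lemma frob_comb0 r e : frob_comb r e (fun _ _ => 0) = 0.
Proof.
by rewrite /frob_comb big1 // => j _; rewrite big1 // => a _; rewrite frob0 mul0r.
Qed.

Lemma frob_combD r e F G :
  frob_comb r e F + frob_comb r e G = frob_comb r e (fun j a => F j a + G j a).
Proof.
rewrite -big_split; apply: eq_bigr => j _; rewrite -big_split /=.
by apply: eq_bigr => a _; rewrite frob_mpolyD mulrDl.
Qed.

Lemma frob_combM r e F s :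
  s ^+ q * frob_comb r e F = frob_comb r e (fun j a => s * F j a).
Proof.
rewrite mulr_sumr; apply: eq_bigr => j _; rewrite mulr_sumr.
by apply: eq_bigr => a _; rewrite mulrA exprMn.
Qed.

Lemma frob_comb_extends r e r' e' F : extends r e r' e' ->
  frob_comb r e F = frob_comb r' e' (fun j a => if (j < r)%N then F j a else 0).
Proof.
case=> le_r e'E; rewrite /frob_comb (big_ord_widen _ (fun j : nat => \sum_a
  F j a ^+ q * (e j *: 'X_[exps_mnm a])) le_r) big_mkcond /=.
apply: eq_bigr => j _; case: ifP => jr.
  by rewrite e'E.
by rewrite big1 // => a _; rewrite frob0 mul0r.
Qed.

(** Multiplication by distinct monomials with exponents below q separates the
    monomials: this is the uniqueness of Euclidean division by q, applied to
    each exponent. *)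
Lemma mcoeff_frob (F : S) (a b : exps) u :
  (F ^+ q * 'X_[exps_mnm b])@_(exps_mnm a + u *+ q)%MM
    = if b == a then F@_u ^+ q else 0.
Proof.
rewrite [F in F ^+ q]mpolyE frob_sum mulr_suml raddf_sum /=.
under eq_bigr => m _ do
  rewrite exprZn mpolyXn -scalerAl -mpolyXD mcoeffZ mcoeffX.
have eq_mnm m : ((m *+ q + exps_mnm b)%MM == (exps_mnm a + u *+ q)%MM)
              = (b == a) && (m == u).
  apply/eqP/andP=> [/mnmP E|[/eqP-> /eqP->]]; last by rewrite addmC.
  have Ei i : (m i * q + b i = u i * q + a i)%N.
    by have := E i; rewrite !mnmDE !mulmnE !mnmE [RHS]addnC.
  split; last first.
    apply/eqP/mnmP=> i; have := congr1 (fun x => x %/ q)%N (Ei i).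
    by rewrite !divnMDl ?frob_gt0 // !divn_small ?ltn_ord // !addn0.
  apply/eqP/ffunP=> i; apply: val_inj; have := congr1 (fun x => x %% q)%N (Ei i).
  by rewrite !modnMDl !modn_small ?ltn_ord.
case: ifP => ba; last first.
  by rewrite big1 // => m _; rewrite eq_mnm ba /= mulr0.
have [uF|uF] := boolP (u \in msupp F).
  rewrite (bigD1_seq u) //= eq_mnm ba eqxx mulr1 big1 ?addr0 // => m mu.
  by rewrite eq_mnm (negPf mu) andbF mulr0.
rewrite (memN_msupp_eq0 uF) frob0 big1_seq // => m /= mF.
rewrite eq_mnm (_ : (m == u) = false) ?andbF ?mulr0 //.
by apply/eqP=> mu; rewrite -mu mF in uF.
Qed.

(** The coefficient of X^(a + q u) in a combination only sees the coefficients
    at u of the coordinates F_(j, a), so that the independence of the scalars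
    e_j applies to them. *)
Lemma frob_comb_eq0 r e F : frob_indep r e -> frob_comb r e F = 0 ->
  forall j a, (j < r)%N -> F j a = 0.
Proof.
move=> ind_e comb0 j a jr; apply/mpolyP=> u; rewrite mcoeff0.
apply: (ind_e (fun j => (F j a)@_u)) jr.
transitivity (frob_comb r e F)@_(exps_mnm a + u *+ q)%MM; last first.
  by rewrite comb0 mcoeff0.
rewrite raddf_sum; apply: eq_bigr => i _ /=; rewrite raddf_sum /=.
under eq_bigr => b _ do rewrite -scalerAr mcoeffZ mcoeff_frob.
rewrite (bigD1 a) //= eqxx big1 ?addr0 1?mulrC // => b ba.
by rewrite (negPf ba) mulr0.
Qed.

Lemma frob_comb_inj r e F G : frob_indep r e ->
  frob_comb r e F = frob_comb r e G -> forall j a, (j < r)%N -> F j a = G j a.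
Proof.
move=> ind_e eqFG j a jr; apply/eqP; rewrite -subr_eq0; apply/eqP.
pose D j a := F j a - G j a; rewrite -[LHS]/(D j a).
apply: (@frob_comb_eq0 r e) => //; apply: (addIr (frob_comb r e G)).
by rewrite frob_combD add0r -eqFG; apply: eq_frob_comb => *; rewrite subrK.
Qed.

Lemma frob_comb_monomial r (e l : nat -> K) m :
  exists F, (\sum_(j < r) l j ^+ q * e j) *: 'X_[m] = frob_comb r e F.
Proof.
pose a : exps := [ffun i => Ordinal (ltn_pmod (m i) frob_gt0)].
pose u : 'X_{1..n} := [multinom (m i %/ q)%N | i < n].
have mE : m = (exps_mnm a + u *+ q)%MM.
  by apply/mnmP=> i; rewrite mnmDE mulmnE !mnmE ffunE /= addnC -divn_eq.
exists (fun j b => if b == a then l j *: 'X_[u] else 0).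
rewrite scaler_suml; apply: eq_bigr => j _; rewrite (bigD1 a) //= eqxx.
rewrite big1 ?addr0 => [|b ba]; last by rewrite (negPf ba) frob0 mul0r.
by rewrite exprZn mpolyXn -scalerAl -scalerAr scalerA -mpolyXD addmC -mE.
Qed.

Lemma frob_comb_exists r e f : frob_indep r e -> exists r' e' F,
  [/\ extends r e r' e', frob_indep r' e' & f = frob_comb r' e' F].
Proof.
move=> ind_e; elim/mpolyind: f => [|k m f _ _ [r1 [e1 [F1 [ext1 ind1 ->]]]]].
  by exists r, e, (fun _ _ => 0); rewrite frob_comb0.
have [r2 [e2 [ext2 ind2 [l ->]]]] := frob_indep_extend k ind1.
have [F2 ->] := frob_comb_monomial r2 e2 l m.
rewrite (frob_comb_extends _ ext2) frob_combD.
by do 3 eexists; split; last reflexivity; rewrite //; apply: extends_trans ext2.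
Qed.

(** If f is the sum of the c_k (a_k)^q, its coordinates are the sums over k of
    a_k times the coordinates of c_k. The family is prolonged on the way, since
    the c_k bring in new scalars. *)
Lemma frobenius_power_comb r e (J : {pred S}) f :
    frob_indep r e -> is_ideal J -> f \in frobenius_power q J ->
  exists r' e' F, [/\ extends r e r' e', frob_indep r' e',
    forall j a, F j a \in J & f = frob_comb r' e' F].
Proof.
move=> ind_e idJ; have J0 : 0 \in J by case: idJ.
move: f; apply: ideal_gen_ind => [|c g f].
  by exists r, e, (fun _ _ => 0); rewrite frob_comb0.
rewrite inE => /asboolP[a aJ ->] [r1 [e1 [F1 [ext1 ind1 FJ ->]]]].
have [r2 [e2 [C [ext2 ind2 ->]]]] := frob_comb_exists c ind1.
rewrite mulrC frob_combM (frob_comb_extends _ ext2) frob_combD.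
do 3 eexists; split; last reflexivity; rewrite //; first exact: extends_trans ext2.
move=> j b; apply: is_idealD => //; first by rewrite mulrC is_idealM.
by case: ifP.
Qed.

(** The coordinates of s^q h are s times those of h. They are computed in a
    family adapted to h alone, so that one list serves all J and s, although
    the comparison takes place in a larger family, where the additional
    coordinates of h vanish. *)
Theorem frobenius_flat (h : S) : exists Fs : seq S, forall (J : {pred S}) s,
  is_ideal J -> (s ^+ q * h \in frobenius_power q J)
                = all (fun F => s * F \in J) Fs.
Proof.
have ind0 : frob_indep 0 (fun _ => 0) by [].
have [r [e [F [_ ind_e hE]]]] := frob_comb_exists h ind0.
exists [seq F j a | j <- iota 0 r, a <- enum exps] => J s idJ.
apply/idP/allP => [shJ _ /allpairsP[[j a]/= [jr _ ->]]|FJ].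
  have [r' [e' [G [ext' ind' GJ]]]] := frobenius_power_comb ind_e idJ shJ.
  have {}jr: (j < r)%N by rewrite mem_iota in jr.
  rewrite hE frob_combM (frob_comb_extends _ ext').
  move/(frob_comb_inj ind')/(_ j a); rewrite jr => -> //.
  by case: ext' => rr' _; apply: leq_trans rr'.
rewrite hE frob_combM.
apply: is_ideal_sum => [|j _]; first exact: frobenius_power_is_ideal.
apply: is_ideal_sum => [|a _]; first exact: frobenius_power_is_ideal.
rewrite mulrC; apply: is_idealM; first exact: frobenius_power_is_ideal.
apply: mem_frobenius_power; apply: FJ; apply/allpairsP; exists (nat_of_ord j, a).
by rewrite mem_iota mem_enum ltn_ord.
Qed.

End FrobeniusFlat.

(** * Least and greatest elements *)

Section NatExtrema.
Implicit Types (A : {pred nat}) (d B : nat).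

Lemma nat_min_le A d : d \in A -> (nat_min A <= d)%N.
Proof.
move=> Ad; rewrite /nat_min; case: pselect => // exA.
by case: ex_minnP => m _; apply.
Qed.

Lemma nat_min_mem A d : d \in A -> nat_min A \in A.
Proof.
move=> Ad; rewrite /nat_min; case: pselect => [exA|[]]; last by exists d.
by case: ex_minnP.
Qed.

Lemma nat_min_empty A : (forall d, d \notin A) -> nat_min A = 0%N.
Proof.
move=> A0; rewrite /nat_min; case: pselect => // exA.
by case: (exA) => d Ad; have := A0 d; rewrite Ad.
Qed.

Lemma nat_max_ge A B d : {in A, forall e, (e <= B)%N} -> d \in A ->
  (d <= nat_max A)%N.
Proof.
move=> leB Ad; have exA : exists d, d \in A by exists d.
case: (ex_maxnP exA leB) => m Am lem.
suff : nat_max A \in [pred d | (d \in A) && `[< {in A, forall e, (e <= d)%N} >]].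
  by rewrite inE => /andP[_ /asboolP]; apply.
apply: (@nat_min_mem _ m); rewrite inE Am; apply/asboolP => e; exact: lem.
Qed.

Lemma nat_max_le A B : {in A, forall e, (e <= B)%N} -> (nat_max A <= B)%N.
Proof.
move=> leB; rewrite /nat_max /nat_min; case: pselect => // exA.
by case: ex_minnP => d; rewrite inE => /andP[/leB].
Qed.

End NatExtrema.

(** * The v-number of a Frobenius power *)

Section Graded.
Variables (K : fieldType) (n : nat).
Local Notation S := {mpoly K[n]}.
Implicit Types (I P G : {pred S}) (f g : S).

Lemma vnumber_le I P f d : prime_ideal P -> colon I f =i P -> f \is d.-homog ->
  (vnumber I <= d)%N.
Proof.
move=> primeP IfP fd; apply: (@leq_trans (local_vnumber I P)).
  apply: nat_min_le; rewrite inE; apply/asboolP; exists P => //.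
  by split=> //; exists f.
by apply: nat_min_le; rewrite inE; apply/asboolP; exists f.
Qed.

Lemma pihomogM_homog f g d b : g \is b.-homog ->
  pihomog mdeg (d + b) (f * g) = pihomog mdeg d f * g.
Proof.
move=> gb; pose k := maxn (msize f) d.+1.
have dk : (d < k)%N by rewrite leq_max leqnn orbT.
rewrite [in LHS](@pihomog_partitionE _ _ mdeg k f) ?leq_maxl //.
rewrite mulr_suml raddf_sum (bigD1 (Ordinal dk)) //= pihomog_dE; last first.
  exact: dhomogM (pihomogP _ _ _) gb.
rewrite big1 ?addr0 // => i ne_id.
apply: (@pihomog_ne0 _ _ _ (i + b)%N); last exact: dhomogM (pihomogP _ _ _) gb.
by rewrite eqn_add2r.
Qed.

(** As I and P are graded, P is contained in I : f_d for each homogeneous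
    component f_d of f. If all these inclusions were strict, the product of
    elements s_d outside P with s_d f_d in I would be outside P but in I : f. *)
Lemma homogeneous_witness I P G f :
    is_ideal I -> graded I -> prime_ideal P ->
    {in G, forall g, g \is homog mdeg} -> P =i ideal_gen G -> colon I f =i P ->
  exists d f', f' \is d.-homog /\ colon I f' =i P.
Proof.
move=> idI gradedI primeP homG PE IfP.
have [[P0 P1 Pid] Pprime] := primeP; have isP : is_ideal P by [].
have subP d : {subset P <= colon I (pihomog mdeg d f)}.
  move=> s; rewrite PE; move: s; apply: ideal_gen_sub.
    exact: colon_is_ideal.
  move=> g gG; have /homogP[b gb] := homG _ gG; rewrite inE -(pihomogM_homog _ _ gb).
  by apply: gradedI; rewrite -[_ \in I]/(g \in colon I f) IfP PE mem_ideal_gen.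
apply: contrapT => nowit.
have bad d : exists2 s, s \notin P & pihomog mdeg d f * s \in I.
  apply: contrapT => nos; apply: nowit; exists d, (pihomog mdeg d f).
  split; first exact: pihomogP.
  move=> s; apply/idP/idP; last exact: subP.
  by apply: contraLR => sP; apply/negP => fsI; apply: nos; exists s.
have [s sP]: exists2 s, s \notin P & f * s \in I.
  rewrite (@pihomog_partitionE _ _ mdeg _ f (leqnn _)).
  elim: (msize f) => [|k [s sP fsI]].
    by exists 1; rewrite ?P1 // big_ord0 mul0r; case: idI.
  have [t tP ftI] := bad k; exists (s * t).
    by apply/negP => /Pprime/orP[]; apply/negP.
  rewrite big_ord_recr /= mulrDl; apply: is_idealD => //.
    by rewrite mulrA mulrC is_idealM.
  by rewrite mulrCA is_idealM.
by rewrite -[_ \in I]/(s \in colon I f) IfP (negPf sP).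
Qed.

Variable q : nat.
Hypothesis q_pnat : [pchar K].-nat q.

(** Let P = I^[q] : h. Since s is in P iff s^q is, flatness makes P the
    intersection of the I : F over the coordinates F of h. Being prime, P is
    one of these finitely many ideals. *)
Lemma associated_prime_frobenius_power I P : is_ideal I ->
  associated_prime (frobenius_power q I) P -> associated_prime I P.
Proof.
move=> idI [primeP [h hP]]; split=> //.
have [[P0 P1 Pid] Pprime] := primeP; have isP : is_ideal P by [].
have [Fs FsP] := frobenius_flat q_pnat h.
have PE s : (s \in P) = all (fun F => s * F \in I) Fs.
  rewrite -FsP // mulrC -[_ * _ \in _]/(s ^+ q \in colon _ h) hP.
  apply/idP/idP; last exact: prime_idealX.
  by move=> sP; rewrite -(prednK (frob_gt0 q_pnat)) exprSr is_idealM.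
apply: contrapT => nowit.
have bad F : F \in Fs -> exists2 s, s \notin P & s * F \in I.
  move=> FFs; apply: contrapT => nos; apply: nowit; exists F => s.
  rewrite inE mulrC; apply/idP/idP => [|]; last by rewrite PE => /allP; apply.
  by apply: contraLR => sP; apply/negP => sFI; apply: nos; exists s.
have [s sP]: exists2 s, s \notin P & all (fun F => s * F \in I) Fs.
  elim: Fs bad {FsP PE} => [|F Fs IHFs] bad; first by exists 1.
  have [t tP tFI] := bad F (mem_head _ _).
  have [|s sP sFs] := IHFs; first by move=> E EFs; apply: bad; rewrite inE EFs orbT.
  exists (s * t); first by apply/negP => /Pprime/orP[]; apply/negP.
  rewrite /= -mulrA is_idealM //=; apply/allP => E /(allP sFs) sEI.
  by rewrite mulrAC mulrC is_idealM.
by rewrite -PE (negPf sP).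
Qed.

(** The generators g_i may be redundant or may not form a regular sequence; then
    f^q times the product of all the g_i^(q - 1) can fall into I^[q], whence a
    maximal choice of exponents instead of a_i = q - 1. *)
Lemma colon_frobenius_witness I P f m (g : 'I_m -> S) :
    is_ideal I -> prime_ideal P -> colon I f =i P ->
    P =i ideal_gen [pred x | [exists i, x == g i]] ->
  exists a : {ffun 'I_m -> 'I_q},
    colon (frobenius_power q I) (f ^+ q * \prod_i g i ^+ a i) =i P.
Proof.
move=> idI primeP IfP PE; set J := frobenius_power q I.
have [[P0 P1 Pid] Pprime] := primeP; have isP : is_ideal P by [].
have idJ : is_ideal J by apply: frobenius_power_is_ideal.
have q_gt0 := frob_gt0 q_pnat.
have memI s : (f * s \in I) = (s \in P) by rewrite -IfP.
pose w (a : {ffun 'I_m -> 'I_q}) := \prod_i g i ^+ a i.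
pose zero : {ffun 'I_m -> 'I_q} := [ffun _ => Ordinal q_gt0].
have wit0 : f ^+ q * w zero \notin J.
  rewrite /w big1 => [|i _]; last by rewrite ffunE.
  (* f^q is in I^[q] iff 1 = 1^q is in P^[q]: both compare the coordinates
     of 1 with P. *)
  have [Fs FsP] := frobenius_flat q_pnat (1 : S).
  rewrite FsP // (eq_all (a2 := fun F => 1 * F \in P)) => [|F]; last first.
    by rewrite memI mul1r.
  rewrite -FsP // expr1n mulr1; apply: contra P1.
  exact: frobenius_power_sub.
case: (@arg_maxnP _ zero (fun a => f ^+ q * w a \notin J)
  (fun a => \sum_i a i)%N wit0) => a wita maxa.
exists a => s; rewrite -/(w a); apply/idP/idP; first rewrite inE.
  apply: contraLR => sP.
  have [Fs FsP] := frobenius_flat q_pnat (w a).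
  apply: contra wita => fwsJ; rewrite FsP //; apply/allP => F FFs.
  have: (f * s) ^+ q * w a \in J.
    rewrite exprMn -{2}(prednK q_gt0) exprSr mulrCA -mulrA mulrAC.
    exact: is_idealM.
  rewrite FsP // => /allP/(_ _ FFs); rewrite -mulrA !memI.
  by move=> /Pprime; rewrite (negPf sP).
rewrite PE; move: s; apply: ideal_gen_sub; first exact: colon_is_ideal.
move=> x; rewrite inE => /existsP[i /eqP->{x}].
rewrite -[_ \in _]/(f ^+ q * w a * g i \in J).
have [ai_lt|ai_ge] := ltnP (a i).+1 q; last first.
  have ai_eq : (a i).+1 = q by apply/eqP; rewrite eqn_leq ltn_ord.
  rewrite /w (bigD1 i) //= mulrA mulrAC -(mulrA (f ^+ q)) -exprSr ai_eq.
  rewrite -exprMn mulrC; apply: is_idealM => //; apply: mem_frobenius_power.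
  by rewrite memI PE mem_ideal_gen // inE; apply/existsP; exists i.
apply: contrapT => /negP; rewrite -mulrA.
pose b := [ffun j => if j == i then Ordinal ai_lt else a j].
have -> : w a * g i = w b.
  rewrite /w (bigD1 i) // [in RHS](bigD1 i) //= mulrAC -exprSr ffunE eqxx.
  by congr (_ * _); apply: eq_bigr => j ji; rewrite ffunE (negPf ji).
move/maxa => /=; rewrite (bigD1 i) // [in leqRHS](bigD1 i) //= ffunE eqxx /=.
rewrite (eq_bigr (fun j => a j : nat)) => [|j ji]; last by rewrite ffunE (negPf ji).
by rewrite /= ltn_add2r ltnn.
Qed.

Lemma vnumber_frobenius_power_le I P m (g : 'I_m -> S) (d : 'I_m -> nat) :
    is_ideal I -> graded I -> associated_prime I P ->
    (forall i, g i \is (d i).-homog) ->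
    P =i ideal_gen [pred x | [exists i, x == g i]] ->
  (vnumber (frobenius_power q I)
     <= q * local_vnumber I P + (q - 1) * \sum_(i < m) d i)%N.
Proof.
move=> idI gradedI [primeP [f0 If0P]] gd PE.
have [|v [f [fv IfP]]] := homogeneous_witness idI gradedI primeP _ PE If0P.
  by move=> x; rewrite inE => /existsP[i /eqP->]; apply/homogP; exists (d i).
have : local_vnumber I P \in
    [pred d | `[< exists2 f, f \is d.-homog & colon I f =i P >]].
  by apply: (@nat_min_mem _ v); rewrite inE; apply/asboolP; exists f.
move=> {fv IfP}; rewrite inE => /asboolP[{}f fv IfP].
have [a aP] := colon_frobenius_witness idI primeP IfP PE.
set v0 := local_vnumber I P in fv *.
have hom : f ^+ q * \prod_i g i ^+ a i \is (v0 * q + \sum_i d i * a i)%N.-homog.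
  apply: dhomogM; first exact: dhomogMn.
  elim/big_rec2: _ => [|i x e _ xe]; first exact: dhomog1.
  by apply: dhomogM => //; apply: dhomogMn.
apply: leq_trans (vnumber_le primeP aP hom) _.
rewrite mulnC leq_add2l big_distrr leq_sum // => i _ /=.
by rewrite mulnC leq_mul2r orbC -ltnS subn1 prednK ?ltn_ord // (frob_gt0 q_pnat).
Qed.

End Graded.

(** * Chains of primes in a polynomial ring *)

Section KrullDimension.
Variables (K : fieldType) (n : nat).
Local Notation S := {mpoly K[n]}.

Lemma big_ord_digits (V : nmodType) (M N : nat) (F : nat -> V) :
  \sum_(e < M * N) F e = \sum_(i < N) \sum_(j < M) F (j * N + i)%N.
Proof.
rewrite exchange_big -(big_mkord xpredT) big_nat_mul big_mkord.
apply: eq_bigr => j _; rewrite -{1}[(j * N)%N]add0n big_addn mulSn addnK.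
by rewrite big_mkord; apply: eq_bigr => i _; rewrite addnC.
Qed.

(** The monomial in xs whose exponents are the base N digits of e, so that
    e < N ^ size xs enumerates all the monomials with exponents below N. *)
Fixpoint digit_monomial N (xs : seq S) (e : nat) : S :=
  if xs is x :: xs' then x ^+ (e %% N) * digit_monomial N xs' (e %/ N) else 1.

(** Elements x_i of c_(i+1) outside c_i are algebraically independent modulo
    c_0. In a relation between them, factor out the least power of x_0 that
    occurs; x_0 can be cancelled modulo c_0, and the remaining constant term in
    x_0 is a relation between x_1, x_2, ... modulo c_1, which contains x_0. *)
Lemma digit_monomials_free N (xs : seq S) (c : nat -> {pred S}) (a : nat -> K) :
    (0 < N)%N ->
    (forall i, (i <= size xs)%N -> prime_ideal (c i)) ->
    (forall i, (i < size xs)%N -> [/\ {subset c i <= c i.+1},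
       xs`_i \in c i.+1 & xs`_i \notin c i]) ->
    \sum_(e < N ^ size xs) a e *: digit_monomial N xs e \in c 0%N ->
  forall e, (e < N ^ size xs)%N -> a e = 0.
Proof.
move=> N_gt0; elim: xs c a => [|x xs IHxs] c a cprime cxs.
  rewrite /= expn0 big_ord1 => a0 [|//] _.
  apply/eqP; apply: contraTT a0 => a0_neq0.
  have [[_ c1 _] _] := cprime 0%N (leqnn _).
  apply: contra c1 => /(@is_idealM _ _ (a 0%N)^-1%:MP).
  rewrite mul_mpolyC scalerA mulVf // scale1r; apply.
  by apply: idealr_closed_is_ideal; case: (cprime 0%N (leqnn _)).
have [/=c01 xc1 xc0] := cxs 0%N (ltn0Sn _).
have primec0 : prime_ideal (c 0%N) by apply: cprime.
have idc1 : is_ideal (c 1%N).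
  by apply: idealr_closed_is_ideal; case: (cprime 1%N).
pose T i := \sum_(j < N ^ size xs) a (j * N + i)%N *: digit_monomial N xs j.
rewrite [size _]/= expnSr.
rewrite (big_ord_digits _ _ (fun e => a e *: digit_monomial N (x :: xs) e)) => sum_c0.
suff a0 i : (i < N)%N -> forall j, (j < N ^ size xs)%N -> a (j * N + i)%N = 0.
  by move=> e; rewrite -ltn_divLR // => /(a0 _ (ltn_pmod e N_gt0)); rewrite -divn_eq.
elim/ltn_ind: i => i IHi iN j jN.
apply: (IHxs (fun i => c i.+1) (fun j => a (j * N + i)%N)) j jN.
- by move=> k; apply: (cprime k.+1).
- by move=> k; apply: (cxs k.+1).
rewrite -/(T i).
have {}sum_c0 : \sum_(0 <= i < N) x ^+ i * T i \in c 0%N.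
  rewrite big_mkord; congr (_ \in c 0%N): sum_c0; apply: eq_bigr => k _.
  rewrite mulr_sumr; apply: eq_bigr => l _ /=.
  by rewrite divnMDl // modnMDl modn_small // divn_small // addn0 scalerAr.
pose U := \sum_(i.+1 <= k < N) x ^+ (k - i.+1) * T k.
have {sum_c0} : x ^+ i * (T i + x * U) \in c 0%N.
  congr (_ \in c 0%N): sum_c0; rewrite (big_cat_nat _ (n := i)) ?(ltnW iN) //=.
  rewrite big_nat big1 ?add0r => [|k /andP[_ ki]]; last first.
    rewrite /T big1 ?mulr0 // => l _; rewrite IHi ?scale0r //.
    exact: ltn_trans iN.
  rewrite big_ltn // mulrDr mulrA -exprSr /U [x ^+ i.+1 * _]mulr_sumr; congr (_ + _).
  apply: eq_big_nat => k /andP[ik _].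
  by rewrite mulrA -exprD subnKC.
case: (primec0) => _ /[apply] /orP[|].
  by move/(prime_idealX primec0); rewrite (negPf xc0).
move/c01 => TU; rewrite -[T i](addrK (x * U)); apply: is_idealB => //.
by rewrite mulrC; apply: is_idealM.
Qed.

Lemma msizeM_leS (x y : S) d e : (msize x <= d.+1)%N -> (msize y <= e.+1)%N ->
  (msize (x * y) <= (d + e).+1)%N.
Proof.
have [->|x0] := eqVneq x 0; first by rewrite mul0r msize0.
have [->|y0] := eqVneq y 0; first by rewrite mulr0 msize0.
move=> xd ye; rewrite msizeM // -subn1 leq_subLR add1n.
by rewrite -addSn -addnS leq_add.
Qed.

Lemma msize_exp_le (x : S) d k : (msize x <= d.+1)%N -> (msize (x ^+ k) <= (k * d).+1)%N.
Proof.
move=> xd; elim: k => [|k IHk]; first by rewrite expr0 msize1.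
by rewrite exprS mulSn msizeM_leS.
Qed.

Lemma msize_digit_monomial N (xs : seq S) d e : (0 < N)%N ->
    all (fun x => msize x <= d.+1)%N xs ->
  (msize (digit_monomial N xs e) <= (size xs * (N * d)).+1)%N.
Proof.
move=> N_gt0; elim: xs e => [|x xs IHxs] e /=; first by rewrite msize1.
move=> /andP[xd xsd]; rewrite mulSn msizeM_leS ?IHxs //.
rewrite (leq_trans (msize_exp_le _ xd)) // ltnS leq_mul2r ltnW ?orbT //.
exact: ltn_pmod.
Qed.

Lemma card_bmultinom B : (#|{: 'X_{1..n < B}}| <= B ^ n)%N.
Proof.
have ltB (m : 'X_{1..n < B}) i : (bmnm m i < B)%N.
  apply: leq_ltn_trans (bmdeg m); rewrite mdegE (bigD1 i) //=.
  exact: leq_addr.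
pose f (m : 'X_{1..n < B}) : {ffun 'I_n -> 'I_B} := [ffun i => Ordinal (ltB m i)].
rewrite -[B in (B ^ _)%N]card_ord -[n in (_ ^ n)%N]card_ord -card_ffun.
apply: (@leq_card _ _ f) => m1 m2 /ffunP eqf; apply/val_inj/mnmP => i.
by have := eqf i; rewrite !ffunE => -[].
Qed.

Lemma linear_dependence (T : finType) r (v : 'I_r -> T -> K) : (#|T| < r)%N ->
  exists2 a : 'I_r -> K, exists i, a i != 0 & forall t, \sum_i a i * v i t = 0.
Proof.
move=> ltTr; pose M := \matrix_(i < r, j < #|T|) v i (enum_val j).
have : kermx M != 0.
  rewrite -mxrank_eq0 mxrank_ker -lt0n subn_gt0.
  exact: leq_ltn_trans (rank_leq_col M) ltTr.
move/rowV0Pn => [u /sub_kermxP uM u0].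
exists (fun i => u 0 i).
  apply: contrapT => u_eq0; move/eqP: u0; apply; apply/rowP => i; rewrite mxE.
  by apply/eqP; apply: contrapT => ui; apply: u_eq0; exists i; apply/negP.
move=> t; have /rowP/(_ (enum_rank t)) := uM; rewrite !mxE => uMt; rewrite -[RHS]uMt.
by apply: eq_bigr => i _; rewrite mxE enum_rankK.
Qed.

(** n + 1 polynomials are algebraically dependent: their N^(n + 1) monomials
    have degrees linear in N, hence lie in a space of dimension O(N^n). *)
Lemma digit_monomials_dependent (xs : seq S) : size xs = n.+1 ->
  exists N, (0 < N)%N /\ exists2 a : nat -> K,
    (exists2 e, (e < N ^ size xs)%N & a e != 0) &
    \sum_(e < N ^ size xs) a e *: digit_monomial N xs e = 0.
Proof.
move=> sz_xs; pose d := (\max_(x <- xs) msize x).+1.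
have xsd : all (fun x => msize x <= d.+1)%N xs.
  by apply/allP => x xxs; do 2 apply: leqW; apply: leq_bigmax_seq.
(* As B <= (n + 2) d N, taking N > ((n + 2) d)^n gives B^n < N^(n + 1). *)
pose N := ((n.+2 * d) ^ n).+1; pose B := (size xs * (N * d)).+1.
exists N; split=> //.
have ltBN : (#|{: 'X_{1..n < B}}| < N ^ size xs)%N.
  apply: leq_ltn_trans (card_bmultinom B) _.
  rewrite sz_xs expnS.
  apply: (@leq_ltn_trans ((n.+2 * d) ^ n * N ^ n)%N); last first.
    by rewrite ltn_pmul2r // expn_gt0.
  have [n0|n_gt0] := posnP n; first by rewrite n0.
  rewrite -expnMn leq_exp2r // /B sz_xs mulnAC -mulnA [in leqRHS]mulSn.
  rewrite -add1n leq_add // mulnC ?leq_mul //.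
pose v (i : 'I_(N ^ size xs)) (m : 'X_{1..n < B}) := (digit_monomial N xs i)@_m.
have [a [j aj0] av0] := linear_dependence v ltBN.
pose a' e := oapp a 0 (insub e); have a'E k : a' (val k) = a k.
  by rewrite /a' valK.
exists a'; first by exists (val j); [exact: ltn_ord | rewrite a'E].
apply/mpolyP => m; rewrite mcoeff0 raddf_sum /=.
under eq_bigr => i _ do rewrite mcoeffZ [a' _]a'E.
have [mB|Bm] := ltnP (mdeg m) B; first exact: (av0 (BMultinom mB)).
rewrite big1 // => i _; rewrite memN_msupp_eq0 ?mulr0 // msize_mdeg_ge //.
by apply: leq_trans Bm; apply: msize_digit_monomial.
Qed.

Lemma prime_chain_length k (c : nat -> {pred S}) : prime_chain k c -> (k <= n)%N.
Proof.
move=> [cprime cinc]; rewrite leqNgt; apply/negP => nk.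
have exx i : exists x, (i < k)%N -> x \in c i.+1 /\ x \notin c i.
  have [ik|_] := ltnP i k; last by exists 0.
  have [_ /existsNP[x xP]] := cinc i ik; exists x => _.
  by move/not_implyP: xP => [? /negP].
have [x xP] := choice exx.
have [N [N_gt0 [a [e eN ae] sum0]]] :=
  digit_monomials_dependent (size_mkseq x n.+1).
have: a e = 0.
  apply: (digit_monomials_free N_gt0 (c := c) _ _ _ eN); rewrite ?sum0 ?size_mkseq.
  - by move=> i ik; apply: cprime; apply: leq_trans ik nk.
  - move=> i ik; have {}ik' := leq_trans ik nk; rewrite nth_mkseq //.
    by have [? ?] := xP i ik'; have [? _] := cinc i ik'.
  - by have [[]] := cprime 0%N (leq0n _).
by move/eqP; apply/negP.
Qed.

Lemma height_ge k (c : nat -> {pred S}) P : prime_chain k c -> c k =i P ->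
  (k <= height P)%N.
Proof.
move=> ck ckP; apply: (@nat_max_ge _ n).
  by move=> e; rewrite inE => /asboolP[c' /prime_chain_length].
by rewrite inE; apply/asboolP; exists c.
Qed.

Lemma height_le (P : {pred S}) : (height P <= n)%N.
Proof.
apply: nat_max_le => e.
by rewrite inE => /asboolP[c /prime_chain_length].
Qed.

Lemma bight_ge (I P : {pred S}) : associated_prime I P -> (height P <= bight I)%N.
Proof.
move=> IP; apply: (@nat_max_ge _ n).
  by move=> e; rewrite inE => /asboolP[Q _ ->]; apply: height_le.
by rewrite inE; apply/asboolP; exists P.
Qed.

End KrullDimension.

(** * Primes generated by linear forms *)

Section LinearForms.
Variables (K : fieldType) (n : nat).
Local Notation S := {mpoly K[n]}.
Implicit Types (I J P : {pred S}) (f : S).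

Definition linear_form (v : 'rV[K]_n) : S := \sum_i v 0 i *: 'X_i.

Lemma linear_form_is_linear : linear linear_form.
Proof.
move=> a u v; rewrite scaler_sumr -big_split; apply: eq_bigr => i _ /=.
by rewrite !mxE scalerDl scalerA.
Qed.

HB.instance Definition _ := GRing.isLinear.Build K 'rV[K]_n S _ linear_form
  linear_form_is_linear.

Lemma linear_form_inj : injective linear_form.
Proof.
move=> u v /(congr1 (fun f i => f@_(U_(i)))) eq_uv; apply/rowP => i.
have coef w : (linear_form w)@_U_(i) = w 0 i.
  rewrite raddf_sum (bigD1 i) //= mcoeffZ mcoeffXU eqxx mulr1 big1 ?addr0 //.
  by move=> j ji; rewrite mcoeffZ mcoeffXU (negPf ji) mulr0.
by rewrite -!coef; apply: (congr1 (fun h => h i) eq_uv).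
Qed.

Lemma linear_form_homog v : linear_form v \is 1.-homog.
Proof.
by apply: rpred_sum => i _; apply: rpredZ; rewrite dhomogX /= mdeg1.
Qed.

Lemma homog1_linear_form f : f \is 1.-homog -> exists v, f = linear_form v.
Proof.
move=> f1; exists (\row_i f@_U_(i)); apply/mpolyP => m.
rewrite raddf_sum /=; under eq_bigr => i _ do rewrite mxE mcoeffZ mcoeffX.
have [m1|m1] := eqVneq (mdeg m) 1%N; last first.
  rewrite (dhomog_nemf_coeff f1 m1) big1 // => i _.
  by case: eqP => [mE|_]; [rewrite -mE mdeg1 in m1 | rewrite mulr0].
have /existsP[i /eqP->] : [exists i, m == U_(i)%MM] by rewrite -mdeg_eq1 m1.
rewrite (bigD1 i) //= eqxx mulr1 big1 ?addr0 // => j ji.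
by rewrite eq_mnm1 (negPf ji) mulr0.
Qed.

Lemma linear_form_mul m (u : 'rV_m) (B : 'M_(m, n)) :
  linear_form (u *m B) = \sum_j u 0 j *: linear_form (row j B).
Proof.
by rewrite mulmx_sum_row linear_sum; apply: eq_bigr => j _; rewrite linearZ.
Qed.

Lemma linear_form_submx J m (B : 'M_(m, n)) v : is_ideal J ->
  (forall j, linear_form (row j B) \in J) -> (v <= B)%MS -> linear_form v \in J.
Proof.
move=> idJ BJ /submxP[u ->]; rewrite linear_form_mul.
by apply: is_ideal_sum => // j _; rewrite -mul_mpolyC; apply: is_idealM.
Qed.

(** Modulo J the substitution is the identity on the variables, hence on all
    polynomials. *)
Lemma sub_comp_mpoly J (t : n.-tuple S) : is_ideal J ->
  (forall i, 'X_i - tnth t i \in J) -> forall f, f - (f \mPo t) \in J.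
Proof.
move=> idJ XtJ; have J0 : 0 \in J by case: idJ.
have subD (a b c d : S) : a - b \in J -> c - d \in J -> a + c - (b + d) \in J.
  by move=> ab cd; rewrite opprD addrACA; apply: is_idealD.
elim/mpolyind => [|c m f _ _ IHf]; first by rewrite comp_mpoly0 subrr.
rewrite comp_mpolyD; apply: subD => //.
rewrite comp_mpolyZ -scalerBr -mul_mpolyC; apply: is_idealM => //.
rewrite comp_mpolyX mpolyXE_id; elim/big_rec2: _ => [|i y x _ xyJ].
  by rewrite subrr.
set a := 'X_i ^+ _; set b := tnth t i ^+ _.
have -> : a * x - b * y = (a - b) * x + b * (x - y).
  by rewrite mulrBl mulrBr addrA subrK.
apply: is_idealD => //; last exact: is_idealM.
by rewrite subrXX mulrC mulrCA mulrC; apply: is_idealM.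
Qed.

(** Projection, acting on row vectors, with kernel the row space of W. *)
Definition proj_along m (W : 'M[K]_(m, n)) : 'M[K]_n := proj_mx W^C%MS <<W>>%MS.

Lemma proj_along_eq0 m (W : 'M_(m, n)) (v : 'rV_n) : (v <= W)%MS -> v *m proj_along W = 0.
Proof.
move=> vW; apply: proj_mx_0; last by rewrite genmxE.
apply/eqP; rewrite -submx0 -(capmx_compl W) sub_capmx capmxSl.
by rewrite (submx_trans (capmxSr _ _)) ?genmxE.
Qed.

Lemma sub_proj_along m (W : 'M_(m, n)) (v : 'rV_n) : (v - v *m proj_along W <= W)%MS.
Proof.
have := @proj_mx_compl_sub _ _ _ W^C%MS <<W>>%MS v; rewrite genmxE; apply.
have := addsmx_compl_full W; rewrite -sub1mx => le1.
rewrite (submx_trans (submx1 v)) // (submx_trans le1) //.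
by rewrite addsmx_sub addsmxSl (submx_trans _ (addsmxSr _ _)) ?genmxE.
Qed.

Definition proj_vars m (W : 'M[K]_(m, n)) : n.-tuple S :=
  [tuple linear_form (row i (proj_along W)) | i < n].

(** The ideal generated by the linear forms in the row space of W, presented as
    the kernel of the substitution induced by a projection along W. This makes
    it evident that the ideal is prime. *)
Definition forms_ideal m (W : 'M[K]_(m, n)) : {pred S} :=
  [pred f | f \mPo proj_vars W == 0].

Lemma comp_linear_form m (W : 'M_(m, n)) v :
  linear_form v \mPo proj_vars W = linear_form (v *m proj_along W).
Proof.
rewrite linear_form_mul raddf_sum; apply: eq_bigr => i _ /=.
by rewrite comp_mpolyZ comp_mpolyXU -tnth_nth tnth_mktuple.
Qed.

Lemma linear_form_in_forms_ideal m (W : 'M_(m, n)) v :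
  (linear_form v \in forms_ideal W) = (v <= W)%MS.
Proof.
rewrite inE comp_linear_form -[X in _ == X](linear0 linear_form).
rewrite (inj_eq linear_form_inj); apply/eqP/idP => [v0|/proj_along_eq0//].
by have := sub_proj_along W v; rewrite v0 subr0.
Qed.

Lemma forms_ideal_prime m (W : 'M_(m, n)) : prime_ideal (forms_ideal W).
Proof.
split; first split.
- by rewrite inE comp_mpoly0.
- by rewrite inE comp_mpoly1 oner_eq0.
- move=> a u v; rewrite !inE => /eqP u0 /eqP v0.
  by rewrite comp_mpolyD rmorphM /= u0 v0 mulr0 addr0.
- by move=> u v; rewrite !inE rmorphM mulf_eq0.
Qed.

(** If f is killed by the substitution then f = f - (f \mPo proj_vars W), and the
    substitution moves each variable by a linear form in W. *)
Lemma forms_ideal_sub J m (W : 'M_(m, n)) : is_ideal J ->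
  (forall v, (v <= W)%MS -> linear_form v \in J) -> {subset forms_ideal W <= J}.
Proof.
move=> idJ WJ f /eqP f0; rewrite -[f]subr0 -f0; apply: sub_comp_mpoly => // i.
have Xi : 'X_i = linear_form (delta_mx 0 i).
  rewrite /linear_form (bigD1 i) //= mxE !eqxx scale1r big1 ?addr0 // => j ji.
  by rewrite mxE (negPf ji) andbF scale0r.
by rewrite tnth_mktuple Xi rowE -linearB WJ // sub_proj_along.
Qed.

Lemma forms_idealS m1 m2 (W1 : 'M_(m1, n)) (W2 : 'M_(m2, n)) :
  {subset forms_ideal W1 <= forms_ideal W2} <-> (W1 <= W2)%MS.
Proof.
split=> [sub12|le12].
  apply/row_subP => i; rewrite -linear_form_in_forms_ideal; apply: sub12.
  by rewrite linear_form_in_forms_ideal row_sub.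
apply: forms_ideal_sub => [|v vW1].
  by apply: idealr_closed_is_ideal; have [] := forms_ideal_prime W2.
by rewrite linear_form_in_forms_ideal (submx_trans vW1).
Qed.

(** The flag spanned by the first k rows of B gives a chain of prime ideals,
    strict because the ranks increase. *)
Lemma forms_ideal_height m (B : 'M_(m, n)) : row_free B ->
  (m <= height (forms_ideal B))%N.
Proof.
move=> freeB; pose W k : 'M_(m, n) := pid_mx k *m B.
apply: (@height_ge _ _ _ (fun k => forms_ideal (W k))); last first.
  by rewrite /W pid_mx_1 mul1mx.
split=> [i _|i im]; first exact: forms_ideal_prime.
split.
  apply/forms_idealS; rewrite submxMfree //; apply/submxP; exists (pid_mx i).
  by rewrite mul_pid_mx (minn_idPl (leqnSn i)) (minn_idPr (ltnW im)).
move/forms_idealS/mxrankS.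
by rewrite !mxrankMfree // !rank_pid_mx ?ltnn // ltnW.
Qed.

(** The linear forms in P are those of a subspace: take one of maximal dimension
    among the subspaces whose forms all lie in P. *)
Lemma linear_part P : is_ideal P -> exists m (B : 'M[K]_(m, n)),
  row_free B /\ forall v, (linear_form v \in P) = (v <= B)%MS.
Proof.
move=> isP.
pose good (A : 'M[K]_n) := forall v : 'rV_n, (v <= A)%MS -> linear_form v \in P.
pose rk d := `[< exists2 A, good A & \rank A = d >].
have rk0 : exists d, rk d.
  exists 0%N; apply/asboolP; exists 0; last by rewrite mxrank0.
  by move=> v; rewrite submx0 => /eqP->; rewrite linear0; case: isP.
have rk_le d : rk d -> (d <= n)%N by move=> /asboolP[A _ <-]; apply: rank_leq_row.
case: (ex_maxnP rk0 rk_le) => d /asboolP[A goodA <-{d}] maxA.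
exists (\rank A), (row_base A); rewrite row_base_free; split=> // v.
rewrite eq_row_base; apply/idP/idP => [vP|]; last exact: goodA.
apply: contraT => vA.
suff /maxA : rk (\rank (A + v)%MS).
  rewrite leqNgt rank_ltmx // ltmxE addsmxSl /=.
  by apply: contra vA; rewrite addsmx_sub => /andP[].
apply/asboolP; exists (A + v)%MS => // w /sub_addsmxP[[u1 u2] /= ->].
rewrite linearD is_idealD //; first by apply: goodA; apply: submxMl.
rewrite [u2]mx11_scalar mul_scalar_mx linearZ /= -mul_mpolyC.
exact: is_idealM.
Qed.

Lemma linear_prime_generators P : prime_ideal P -> generated_by_linear_forms P ->
  exists m (g : 'I_m -> S), [/\ forall i, g i \is 1.-homog,
    P =i ideal_gen [pred x | [exists i, x == g i]] & (m <= height P)%N].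
Proof.
move=> [[P0 P1 Pid] _] [L L1 PL]; have isP : is_ideal P by [].
have [m [B [freeB BP]]] := linear_part isP.
have PB : P =i forms_ideal B.
  move=> f; apply/idP/idP; last first.
    by apply: forms_ideal_sub => // v; rewrite BP.
  rewrite PL; apply: ideal_gen_sub f => [|l lL].
    by apply: idealr_closed_is_ideal; have [] := forms_ideal_prime B.
  have [v lE] := homog1_linear_form (L1 _ lL).
  by rewrite lE linear_form_in_forms_ideal -BP -lE PL mem_ideal_gen.
exists m, (fun j => linear_form (row j B)); split.
- by move=> i; apply: linear_form_homog.
- move=> f; apply/idP/idP.
    rewrite PB; apply: forms_ideal_sub => [|v]; first exact: ideal_gen_is_ideal.
    apply: linear_form_submx => [|j]; first exact: ideal_gen_is_ideal.
    by apply: mem_ideal_gen; rewrite inE; apply/existsP; exists j.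
  apply: ideal_gen_sub => // x; rewrite inE => /existsP[j /eqP->].
  by rewrite BP row_sub.
- have -> : P = forms_ideal B by apply/funext => f; apply: PB.
  exact: forms_ideal_height.
Qed.

End LinearForms.

(** * The bounds *)

Theorem proposition4p5 (K : fieldType) (p : nat) (charK : p \in [pchar K])
    (n : nat) (I : {pred {mpoly K[n]}})
    (properI : idealr_closed I) (gradedI : graded I) :
  (forall P : {pred {mpoly K[n]}}, associated_prime I P ->
   forall (m : nat) (g : 'I_m -> {mpoly K[n]}),
     (forall i, g i \is homog mdeg) -> minimally_generates g P ->
   forall q e : nat, q = (p ^ e)%N -> (1 < q)%N ->
     (vnumber (frobenius_power q I)
        <= q * local_vnumber I P + (q - 1) * \sum_(i < m) degree (g i))%N)
  /\
  ((forall P : {pred {mpoly K[n]}}, associated_prime I P ->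
      generated_by_linear_forms P) ->
   forall q e : nat, q = (p ^ e)%N -> (1 < q)%N ->
     (vnumber (frobenius_power q I)
        <= q * vnumber I + (q - 1) * bight I)%N).
Proof.
have idI := idealr_closed_is_ideal properI.
have q_pnat e : [pchar K].-nat (p ^ e)%N.
  by rewrite pnatX pnatE ?charK // (pcharf_prime charK).
split=> [P assP m g homg [genP _] q e -> _|linP q e -> _].
  apply: (vnumber_frobenius_power_le (q_pnat e) idI gradedI assP (g := g)) => // f.
  rewrite genP; congr (f \in ideal_gen _).
  apply/funext => x /=; apply: eq_existsb => i.
  by rewrite in_setT.
set J := frobenius_power _ I.
(* Without associated primes, the v-number of J is 0 by convention. *)
have [[Q JQ]|noQ] := EM (exists Q, associated_prime J Q); last first.
  rewrite /vnumber nat_min_empty // => d; apply/negP.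
  by rewrite inE => /asboolP[Q JQ _]; apply: noQ; exists Q.
have IQ := associated_prime_frobenius_power (q_pnat e) idI JQ.
have : vnumber I \in
    [pred d | `[< exists2 P, associated_prime I P & d = local_vnumber I P >]].
  apply: (@nat_min_mem _ (local_vnumber I Q)); rewrite inE.
  by apply/asboolP; exists Q.
rewrite inE => /asboolP[P IP ->].
have [m [g [g1 gP mP]]] := linear_prime_generators IP.1 (linP P IP).
apply: leq_trans (vnumber_frobenius_power_le (q_pnat e) idI gradedI IP g1 gP) _.
rewrite leq_add2l leq_mul2l sum1_card card_ord.
by rewrite (leq_trans mP (bight_ge IP)) orbT.
Qed.
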